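(* Let $X$ be a real Banach space and let $M \subseteq X$ be an $M$-ideal in $X$. If $X^*$ has the $w^*$-Slice diameter two property, then $M^*$ has the $w^*$-Slice diameter two property.
   Context: All Banach spaces are real and nonzero (in particular $M \neq \{0\}$). For a Banach space $Z$, $Z^*$ is its dual and $B_Z$ its closed unit ball. Diameters are taken with respect to the norm. $M$-ideals. A linear projection $P$ on a Banach space $Z$ is an $L$-projection if $\|z\| = \|Pz\| + \|z - Pz\|$ for all $z \in Z$. For a subspace $M \subseteq X$, its annihilator is $M^\perp = \{x^* \in X^* : x^*(m) = 0 \ \forall m \in M\}$. A closed subspace $M \subseteq X$ is an $M$-ideal in $X$ if there is an $L$-projection $P : X^* \to X^*$ with $\ker P = M^\perp$. $w^*$-slices. For a Banach space $Z$, a $w^*$-slice of $B_{Z^*}$ is a set of the form $\{z^* \in B_{Z^*} : z^*(z) > \sup_{u^* \in B_{Z^*}} u^*(z) - \alpha\}$ with $z \in Z$ and $\alpha > 0$. The dual space $Z^*$ has the $w^*$-Slice diameter two property if every $w^*$-slice of $B_{Z^*}$ has diameter $2$. *)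

(* Defs.v *)
From HB Require Import structures.
From mathcomp Require Import all_boot all_order all_algebra.
From mathcomp Require Import all_classical all_reals all_analysis.

Set Implicit Arguments.
Unset Strict Implicit.
Unset Printing Implicit Defensive.

Import Order.TTheory GRing.Theory Num.Theory.
Import numFieldNormedType.Exports.

Local Open Scope classical_set_scope.
Local Open Scope ring_scope.

Definition unit_ball (R : realType) (Z : normedModType R) : set Z :=
  [set z | `|z| <= 1].
Arguments unit_ball {R} Z.

(* An empty set has diameter -oo, an unbounded one +oo. *)
Definition diam (R : realType) (Z : normedModType R) (A : set Z) : \bar R :=
  ereal_sup [set (`|p.1 - p.2|)%:E | p in A `*` A].

Section Dual.
Context {R : realType} (Z : normedModType R).

Definition continuous_linear_form : {pred Z -> R^o} :=
  fun f => `[< linear f /\ continuous f >].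

Fact continuous_linear_form_submod : submod_closed continuous_linear_form.
Proof.
split=> [|a f g /asboolP[lf cf] /asboolP[lg cg]]; apply/asboolP; split.
- by move=> b u v; rewrite /= scaler0 addr0.
- exact: cst_continuous.
- move=> b u v; rewrite -![(_ + _) _]/(_ + _) -![(a *: f) _]/(a *: _) lf lg.
  by rewrite !scalerDr !scalerA mulrC addrACA.
- by move=> x; apply: cvgD; [apply: cvgZl_tmp; exact: cf|exact: cg].
Qed.

HB.instance Definition _ := GRing.isSubmodClosed.Build R (Z -> R^o)
  continuous_linear_form continuous_linear_form_submod.

Record dual := Dual {
  dual_val :> Z -> R^o;
  dual_valP : dual_val \in continuous_linear_form }.

HB.instance Definition _ := [isSub for dual_val].
HB.instance Definition _ := [Choice of dual by <:].
HB.instance Definition _ := [SubChoice_isSubLmodule of dual by <:].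

Lemma dual_linear (f : dual) : linear f.
Proof. by case: f => f /= /asboolP[]. Qed.

Lemma dual_continuous (f : dual) : continuous f.
Proof. by case: f => f /= /asboolP[]. Qed.

HB.instance Definition _ (f : dual) :=
  GRing.isLinear.Build R Z R^o *:%R (dual_val f) (dual_linear f).

Definition dual_norm (f : dual) : R := sup [set `|f z| | z in unit_ball Z].


Let dual_norm_has_sup (f : dual) : has_sup [set `|f z| | z in unit_ball Z].
Proof.
split; first by exists `|f 0|, 0 => //=; rewrite /unit_ball/= normr0.
have /linear_bounded_continuous/bounded_funP/(_ 1)[k fk] :
  continuous (f : {linear Z -> R^o}) by exact: dual_continuous.
by exists k => _ /= [z z1 <-]; exact: fk.
Qed.

Lemma dual_norm_ub (f : dual) z : `|z| <= 1 -> `|f z| <= dual_norm f.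
Proof.
by move=> z1; apply: sup_upper_bound; [exact: dual_norm_has_sup|exists z].
Qed.

Lemma dual_norm_le (f : dual) c :
  (forall z, `|z| <= 1 -> `|f z| <= c) -> dual_norm f <= c.
Proof.
move=> fc; apply: ge_sup; first by have [] := dual_norm_has_sup f.
by move=> _ [z z1 <-]; exact: fc.
Qed.

Let dual_normD (f g : dual) : dual_norm (f + g) <= dual_norm f + dual_norm g.
Proof.
apply: dual_norm_le => z z1; rewrite -[(f + g) z]/(f z + g z).
by rewrite (le_trans (ler_normD _ _))// lerD// dual_norm_ub.
Qed.

Let dual_normZ_le (a : R) (f : dual) : dual_norm (a *: f) <= `|a| * dual_norm f.
Proof.
apply: dual_norm_le => z z1; rewrite -[(a *: f) z]/(a * f z) normrM.
by rewrite ler_wpM2l// dual_norm_ub.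
Qed.

Let dual_normZ (a : R) (f : dual) : dual_norm (a *: f) = `|a| * dual_norm f.
Proof.
apply/eqP; rewrite eq_le dual_normZ_le /=.
have [->|a0] := eqVneq a 0.
  rewrite normr0 mul0r; apply: le_trans (normr_ge0 _) (dual_norm_ub _ (z := 0) _).
  by rewrite normr0.
rewrite -ler_pdivlMl ?normr_gt0// -normfV.
by rewrite -[X in dual_norm X <= _](scalerK a0) dual_normZ_le.
Qed.

Let dual_norm_eq0 (f : dual) : dual_norm f = 0 -> f = 0.
Proof.
move=> f0; apply/val_inj/funext => z; rewrite -[RHS]/(0 : R).
have [->|z0] := eqVneq z 0; first exact: (linear0 (f : {linear Z -> R^o})).
have nz : `|z| != 0 by rewrite normr_eq0.
have : `|f (`|z|^-1 *: z)| <= 0.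
  by rewrite -f0 dual_norm_ub// normrZ normfV normr_id mulVf.
rewrite linearZ/= normr_le0 scaler_eq0 invr_eq0.
by rewrite (negbTE nz) => /eqP.
Qed.

HB.instance Definition _ := Lmodule_isNormed.Build R dual
  dual_normD dual_normZ dual_norm_eq0.

End Dual.

Section Subspace.
Context {R : realType} (X : normedModType R) (M : submodClosed X).

Record subspace_of := SubspaceOf {
  subspace_val :> X;
  subspace_valP : subspace_val \in M }.

HB.instance Definition _ := [isSub for subspace_val].
HB.instance Definition _ := [Choice of subspace_of by <:].
HB.instance Definition _ := [SubChoice_isSubLmodule of subspace_of by <:].

Definition subspace_norm (m : subspace_of) : R := `|val m|.

Let subspace_normD (m n : subspace_of) :
  subspace_norm (m + n) <= subspace_norm m + subspace_norm n.
Proof. by rewrite /subspace_norm raddfD ler_normD. Qed.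

Let subspace_normZ (a : R) (m : subspace_of) :
  subspace_norm (a *: m) = `|a| * subspace_norm m.
Proof. by rewrite /subspace_norm linearZ normrZ. Qed.

Let subspace_norm_eq0 (m : subspace_of) : subspace_norm m = 0 -> m = 0.
Proof. by move=> /normr0_eq0 m0; apply/val_inj; rewrite m0 raddf0. Qed.

HB.instance Definition _ := Lmodule_isNormed.Build R subspace_of
  subspace_normD subspace_normZ subspace_norm_eq0.

Definition annihilator : set (dual X) :=
  [set f : dual X | forall m, m \in M -> f m = 0].

End Subspace.

Definition L_projection (R : realType) (Z : normedModType R)
    (P : {linear Z -> Z}) : Prop :=
  idempotent_fun P /\ forall z, `|z| = `|P z| + `|z - P z|.

Definition M_ideal (R : realType) (X : normedModType R) (M : submodClosed X) :
    Prop :=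
  closed [set` M] /\
  exists P : {linear dual X -> dual X},
    L_projection P /\ P @^-1` [set 0] = annihilator M.

Definition wstar_slice (R : realType) (Z : normedModType R) (z : Z) (alpha : R) :
    set (dual Z) :=
  [set f | unit_ball (dual Z) f /\
           f z > sup [set (u : dual Z) z | u in unit_ball (dual Z)] - alpha].

(* A property of [dual Z]; the argument is the predual because w*-slices are
   determined by the elements of [Z]. *)
Definition dual_wstar_slice_D2P (R : realType) (Z : normedModType R) : Prop :=
  forall (z : Z) (alpha : R), 0 < alpha -> diam (wstar_slice z alpha) = 2%:E.

(* Main.v *)
Require Import Defs.
From HB Require Import structures.
From mathcomp Require Import all_boot all_order all_algebra.
From mathcomp Require Import all_classical all_reals all_analysis.
From mathcomp Require Import lra.

Import Order.TTheory GRing.Theory Num.Theory.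
Import numFieldNormedType.Exports.

Local Open Scope classical_set_scope.
Local Open Scope ring_scope.

(** Write [P] for the L-projection of [X^*] with kernel the annihilator of [M].
    Restriction to [M] identifies [P X^*] isometrically with [M^*]: [f] and
    [P f] agree on [M], so the restriction of [f] has norm at most [`|P f|];
    conversely, if [h] is a Hahn-Banach extension of the restriction of [f],
    then [h - f] annihilates [M], hence [P f = P h] and
    [`|P f| <= `|h| <= `|f restricted to M|] ([norm_restrict]).

    Let now [m != 0] be in [M]. By Hahn-Banach the slices defined by [m] in both
    dual balls are given by the same inequality [f m > `|m| - alpha]
    ([wstar_sliceE]). If [f] lies in a thin slice of the ball of [X^*] defined
    by [m], then [f m = (P f) m] forces [`|P f|] to be almost 1, and
    [`|f| = `|P f| + `|f - P f|] then forces [f - P f] to be almost 0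
    ([norm_sub_L_projection]). Two elements of this thin slice at distance
    almost 2 therefore restrict to two elements of the slice of the ball of
    [M^*] whose distance is the norm of the image under [P] of their difference,
    again almost 2 ([diam_slice_ge2]). For [m = 0] the slice is the whole ball,
    which contains the slices defined by the nonzero vectors of [M].

    All extensions come from the dominated form of Hahn-Banach
    ([hahn_banach]): with the norm as bound it yields norming functionals, and
    with a multiple of the norm it yields extensions from [M] of equal norm. *)

(** * The Hahn-Banach theorem *)

Section HahnBanach.
Context {R : realType} {V : lmodType R} (p : V -> R).
Hypothesis pD : forall u v, p (u + v) <= p u + p v.
Hypothesis pZ : forall (t : R) v, 0 <= t -> p (t *: v) = t * p v.

(** Partial linear forms are encoded by their graphs. Functionality is left out:
    a linear relation lying below a sublinear [p] has [r <= p 0 = 0] and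
    [- r <= 0] for each of its points [(0, r)], so it is a function. *)
Definition linear_relation (G : set (V * R^o)) : Prop :=
  forall a x y, G x -> G y -> G (a *: x + y).

Definition dominated (G : set (V * R^o)) : Prop :=
  forall x, G x -> x.2 <= p x.1.

Let linear_dominated G := linear_relation G /\ dominated G.

Definition extend_graph (G : set (V * R^o)) (z : V * R^o) : set (V * R^o) :=
  [set y | exists x t, G x /\ y = x + t *: z].

Lemma linear_relation_extend_graph G z :
  linear_relation G -> linear_relation (extend_graph G z).
Proof.
move=> linG a _ _ [x [s [Gx ->]]] [y [t [Gy ->]]].
exists (a *: x + y), (a * s + t); split; first exact: linG.
by rewrite scalerDr scalerDl scalerA addrACA.
Qed.

(** The value [c] at [v] has to lie above all [x.2 - p (x.1 - v)] and below all
    [p (y.1 + v) - y.2], with [x] and [y] in [G]; such a [c] exists because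
    [x.2 + y.2 <= p (x.1 + y.1) <= p (x.1 - v) + p (y.1 + v)]. *)
Lemma dominated_extend_graph G v : G 0 -> linear_relation G -> dominated G ->
  exists c, dominated (extend_graph G (v, c)).
Proof.
move=> G0 linG domG.
have GZ a x : G x -> G (a *: x).
  by move=> Gx; rewrite -[_ *: _]addr0; exact: linG.
pose L := [set x.2 - p (x.1 - v) | x in G].
have ubL y : G y -> ubound L (p (y.1 + v) - y.2).
  move=> Gy _ [x Gx <-]; have /= := domG _ (linG 1 _ _ Gx Gy).
  rewrite scale1r !scale1r => h; have := pD (x.1 - v) (y.1 + v).
  by rewrite addrACA addNr addr0; lra.
exists (sup L) => _ [x [t [Gx ->]]] /=.
have [t0|t0|->] := ltrgtP t 0; last first.
- by rewrite !scale0r !addr0; exact: domG.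
- have tx : t^-1 *: (x.1 + t *: v) = t^-1 *: x.1 + v.
    by rewrite scalerDr scalerA mulVf ?gt_eqF// scale1r.
  have : sup L <= p (t^-1 *: x.1 + v) - t^-1 * x.2.
    apply: ge_sup; last exact: ubL (GZ _ _ Gx).
    by exists (0 - p (0 - v)); exists 0.
  rewrite -tx pZ; last by rewrite invr_ge0 ltW.
  rewrite -mulrBr mulrC ler_pdivlMr// -[_ *: sup L]/(t * _).
  by lra.
- have s0 : 0 < - t by rewrite oppr_gt0.
  have tx : (- t)^-1 *: (x.1 + t *: v) = (- t)^-1 *: x.1 - v.
    by rewrite scalerDr scalerA invrN mulNr mulVf ?lt_eqF// scaleN1r.
  have : (- t)^-1 * x.2 - p ((- t)^-1 *: x.1 - v) <= sup L.
    apply: ub_le_sup; first by exists (p (0 + v) - 0); exact: (ubL 0).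
    by exists ((- t)^-1 *: x) => //; exact: GZ.
  rewrite -tx pZ; last by rewrite invr_ge0 ltW.
  rewrite -mulrBr ler_pdivrMl// -[_ *: sup L]/(t * _).
  by lra.
Qed.

(** Zorn's lemma gives a maximal dominated linear relation containing [G]; the
    previous lemma shows that it is defined at each vector. *)
Theorem hahn_banach (G : set (V * R^o)) :
  G 0 -> linear_relation G -> dominated G ->
  exists f : V -> R^o, [/\ linear f, forall v, f v <= p v &
    forall x, G x -> f x.1 = x.2].
Proof.
move=> G0 linG domG.
(* Joining [G] to each set makes the union of the empty chain admissible. *)
have chain F : F `<=` [set A | linear_dominated (G `|` A)] ->
    total_on F subset -> linear_dominated (G `|` \bigcup_(A in F) A).
  move=> FP Ftot.
  have local x : (G `|` \bigcup_(A in F) A) x ->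
      exists2 A, (F A \/ A = set0) & (G `|` A) x.
    by case=> [Gx|[A FA Ax]]; [exists set0; [right|left]|exists A; [left|right]].
  have good A : F A \/ A = set0 -> linear_dominated (G `|` A).
    by case=> [/FP//|->]; rewrite setU0.
  have sub A : F A \/ A = set0 -> G `|` A `<=` G `|` \bigcup_(A in F) A.
    by case=> [FA|->]; [apply: setUS => x Ax; exists A|rewrite setU0; left].
  have tot A B : F A \/ A = set0 -> F B \/ B = set0 -> A `<=` B \/ B `<=` A.
    move=> [FA|->] [FB|->]; by [exact: Ftot|right|left].
  split=> [a x y /local[A FA Ax] /local[B FB By]|x /local[A /good[_ dA] /dA//]].
  have [AB|BA] := tot _ _ FA FB.
    by apply: (sub _ FB); apply: (good _ FB).1 => //; exact: setUS AB _ Ax.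
  by apply: (sub _ FA); apply: (good _ FA).1 => //; exact: setUS BA _ By.
have [A [[linA domA] maxA]] := Zorn_bigcup chain.
set H := G `|` A in linA domA.
have H0 : H 0 by left.
have Htotal v : exists c, H (v, c).
  have [c domE] := dominated_extend_graph H v H0 linA domA.
  exists c; set E := extend_graph H (v, c) in domE.
  have HE : H `<=` E.
    by move=> x Hx; exists x, 0; split; rewrite // scale0r addr0.
  have GE : G `|` E = E by apply/setUidPr => x Gx; apply: HE; left.
  have : ~ A `<` E.
    move/maxA; apply; rewrite /= GE; split=> //.
    exact: linear_relation_extend_graph.
  move=> AE; right; apply: contrapT => nA; apply: AE; split.
    by move=> x Ax; apply: HE; right.
  move/(_ (v, c)) => /=; apply: contra_not nA; apply.
  by exists 0, 1; rewrite scale1r add0r.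
have Hfun v r s : H (v, r) -> H (v, s) -> r = s.
  have p0 : p 0 = 0 by rewrite -[0 in LHS](scale0r 0) pZ// mul0r.
  have le a b : H (v, a) -> H (v, b) -> a <= b.
    move=> Ha Hb; have /= := domA _ (linA (- 1) _ _ Hb Ha).
    by rewrite !scaleN1r addNr p0 => ?; lra.
  by move=> Hr Hs; apply/eqP; rewrite eq_le !le.
pose f v : R^o := projT1 (cid (Htotal v)).
have Hf v : H (v, f v) := projT2 (cid (Htotal v)).
exists f; split=> [a u v|v|x Gx].
- exact: (Hfun (a *: u + v)) (Hf _) (linA a _ _ (Hf u) (Hf v)).
- exact: (domA _ (Hf v)).
- by apply: (Hfun x.1) (Hf _) _; left; case: x Gx.
Qed.

End HahnBanach.

(** * Dual spaces, slices and diameters *)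

Section DualSpace.
Context {R : realType} {Z : normedModType R}.

Lemma dual_ext (f g : dual Z) : (forall z, f z = g z) -> f = g.
Proof. by move=> fg; apply/val_inj/funext. Qed.

Lemma dual_apply_le (f : dual Z) z : `|f z| <= `|f| * `|z|.
Proof.
have [->|z0] := eqVneq z 0.
  by rewrite (linear0 (f : {linear Z -> R^o})) !normr0 mulr0.
have nz : 0 < `|z| by rewrite normr_gt0.
have : `|f (`|z|^-1 *: z)| <= `|f|.
  by apply: dual_norm_ub; rewrite normrZ normfV normr_id mulVf// gt_eqF.
rewrite linearZ/= -[_ *: f z]/(_ * f z) normrM normfV normr_id.
by rewrite ler_pdivrMl// mulrC.
Qed.

(** The upper bound on [f z] alone suffices: applied to [- z] it bounds
    [`|f z|]. *)
Lemma dual_of_bounded_linear (f : Z -> R^o) c : 0 <= c ->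
  linear f -> (forall z, f z <= c * `|z|) ->
  exists2 F : dual Z, (forall z, F z = f z) & `|F| <= c.
Proof.
move=> c0 linf fc.
pose lf : {linear Z -> R^o} :=
  HB.pack f (GRing.isLinear.Build R Z R^o *:%R f linf).
have nfc z : `|f z| <= c * `|z|.
  by rewrite ler_norml fc andbT lerNl -(linearN lf) -(normrN z) fc.
have fcont : f \in @continuous_linear_form R Z.
  apply/asboolP; split => //.
  apply/(linear_bounded_continuous lf)/bounded_funP => r; exists (c * r) => z zr.
  exact: le_trans (nfc z) (ler_wpM2l c0 zr).
exists (Dual fcont) => //; apply: dual_norm_le => z z1.
by rewrite (le_trans (nfc z))// ler_piMr.
Qed.

Lemma norm_sublinear (c : R) : 0 <= c ->
  (forall u v : Z, c * `|u + v| <= c * `|u| + c * `|v|) /\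
  (forall (t : R) (v : Z), 0 <= t -> c * `|t *: v| = t * (c * `|v|)).
Proof.
move=> c0; split=> [u v|t v t0]; first by rewrite -mulrDr ler_wpM2l// ler_normD.
by rewrite normrZ ger0_norm// mulrCA.
Qed.

Lemma dual_extension (G : set (Z * R^o)) c : 0 <= c -> G 0 ->
  linear_relation G -> dominated (fun z => c * `|z|) G ->
  exists2 F : dual Z, (forall x, G x -> F x.1 = x.2) & `|F| <= c.
Proof.
move=> c0 G0 linG domG; have [cD cZ] := norm_sublinear c c0.
have [f [linf fc fG]] := hahn_banach _ cD cZ G G0 linG domG.
have [F Ff Fc] := dual_of_bounded_linear f c c0 linf fc.
by exists F => // x Gx; rewrite Ff fG.
Qed.

Lemma norming_functional (z : Z) : exists2 f : dual Z, `|f| <= 1 & f z = `|z|.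
Proof.
pose G := [set x : Z * R^o | exists t, x = (t *: z, t * `|z|)].
have [|a _ _ [s ->] [t ->]|_ [t ->]/=|f fG f1] := dual_extension G 1 ler01.
- by exists 0; rewrite scale0r mul0r.
- by exists (a * s + t); rewrite scalerDl mulrDl -scalerA -mulrA.
- by rewrite mul1r normrZ ler_wpM2r// ler_norm.
exists f => //; apply: (fG (z, `|z|)).
by exists 1; rewrite scale1r mul1r.
Qed.

Lemma sup_unit_ball_dual (z : Z) :
  sup [set (u : dual Z) z | u in unit_ball (dual Z)] = `|z|.
Proof.
have ub : ubound [set (u : dual Z) z | u in unit_ball (dual Z)] `|z|.
  move=> _ [u u1 <-]; apply: le_trans (ler_norm _) _.
  by apply: le_trans (dual_apply_le u z) _; rewrite ler_piMl.
apply/eqP; rewrite eq_le ge_sup//=; last first.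
  by exists ((0 : dual Z) z), 0; rewrite /unit_ball/= ?normr0.
have [f f1 <-] := norming_functional z.
by apply: ub_le_sup; [exact: ex_intro ub|exists f].
Qed.

Lemma wstar_sliceE (z : Z) alpha :
  wstar_slice z alpha = [set f : dual Z | `|f| <= 1 /\ `|z| - alpha < f z].
Proof. by rewrite /wstar_slice sup_unit_ball_dual. Qed.

Lemma diam_le2 (A : set (dual Z)) :
  A `<=` unit_ball (dual Z) -> (diam A <= 2%:E)%E.
Proof.
move=> A1; apply: ge_ereal_sup => _ [[f g] [/= /A1 f1 /A1 g1] <-].
by rewrite lee_fin (le_trans (ler_normB _ _))// [leRHS](_ : 2 = 1 + 1)// lerD.
Qed.

Lemma diam_ge2 (A : set (dual Z)) :
  (forall e, 0 < e -> exists f g, [/\ A f, A g & 2 - e <= `|f - g|]) ->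
  (2%:E <= diam A)%E.
Proof.
move=> Afar; apply/lee_addgt0Pr => e /Afar[f [g [Af Ag fg]]].
rewrite -leeBlDr// -EFinB; apply: le_ereal_sup_tmp.
by exists (`|f - g|)%:E; [exists (f, g)|rewrite lee_fin].
Qed.

End DualSpace.

(** * Restriction to an M-ideal *)

Section MIdeal.
Context {R : realType} {X : normedModType R} (M : submodClosed X).

Lemma restrict_subproof (f : dual X) :
  exists2 F : dual (subspace_of M), (forall m, F m = f (val m)) & `|F| <= `|f|.
Proof.
apply: (dual_of_bounded_linear (fun m : subspace_of M => f (val m))) => //.
- by move=> a u v; rewrite [val _]linearP; exact: dual_linear.
- by move=> m; apply: le_trans (ler_norm _) (dual_apply_le f _).
Qed.

Definition restrict (f : dual X) : dual (subspace_of M) :=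
  s2val (cid2 (restrict_subproof f)).

Lemma restrictE f m : restrict f m = f (val m).
Proof. by rewrite /restrict; case: cid2. Qed.

Lemma norm_restrict_le f : `|restrict f| <= `|f|.
Proof. by rewrite /restrict; case: cid2. Qed.

Lemma restrictB f g : restrict (f - g) = restrict f - restrict g.
Proof.
by apply: dual_ext => m; rewrite -[RHS]/(restrict f m - restrict g m) !restrictE.
Qed.

Lemma restrict_eqP f g :
  restrict f = restrict g <-> annihilator M (f - g).
Proof.
split=> [fg m mM|fg].
  rewrite -[LHS]/(f m - g m).
  have := congr1 (fun h : dual _ => h (SubspaceOf mM)) fg.
  by rewrite !restrictE => ->; rewrite subrr.
apply: dual_ext => -[m mM]; rewrite !restrictE/=.
by apply/eqP; rewrite -subr_eq0; apply/eqP; exact: fg.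
Qed.

Lemma norm_preserving_extension (g : dual (subspace_of M)) :
  exists2 f : dual X, restrict f = g & `|f| <= `|g|.
Proof.
pose G := [set x : X * R^o | exists m : subspace_of M, x = (val m, g m)].
have [|a _ _ [s ->] [t ->]|_ [m ->]/=|f fG fg] :=
    dual_extension G `|g| (normr_ge0 _).
- by exists 0; rewrite (linear0 (g : {linear _ -> R^o})).
- by exists (a *: s + t); rewrite [val (_ + _)]linearP [g (_ + _)]linearP.
- exact: le_trans (ler_norm _) (dual_apply_le g m).
exists f => //; apply: dual_ext => m; rewrite restrictE.
by apply: (fG (val m, g m)); exists m.
Qed.

Context (P : {linear dual X -> dual X}).
Hypotheses (LP : L_projection P) (kerP : P @^-1` [set 0] = annihilator M).

Lemma restrict_L_projection f : restrict (P f) = restrict f.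
Proof.
apply/restrict_eqP; rewrite -kerP /= linearB.
by apply/eqP; rewrite subr_eq0; apply/eqP; exact: LP.1.
Qed.

(** [P f] depends only on the restriction of [f], because the kernel of [P] is
    the annihilator of [M]; so [f] may be replaced by an extension of that
    restriction with the same norm, and [P] does not increase norms. *)
Lemma norm_restrict f : `|restrict f| = `|P f|.
Proof.
apply/eqP; rewrite eq_le -{1}restrict_L_projection norm_restrict_le/=.
have [h hf] := norm_preserving_extension (restrict f); apply: le_trans.
have -> : P f = P h.
  apply/eqP; rewrite eq_sym -subr_eq0 -linearB; apply/eqP.
  by rewrite -[_ = 0]/((P @^-1` [set 0]) _) kerP; apply/restrict_eqP.
by rewrite [leRHS]LP.2 lerDl.
Qed.

(** [f] and [P f] agree on [M], so [f] being almost norming at [m] leaves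
    [`|P f| > 1 - d]; the L-identity for [f] leaves less than [d] for the other
    summand. *)
Lemma norm_sub_L_projection (f : dual X) (m : X) d : m \in M ->
  `|f| <= 1 -> `|m| * (1 - d) < f m -> m != 0 -> `|f - P f| < d.
Proof.
move=> mM f1 fm m0; have nm : 0 < `|m| by rewrite normr_gt0.
have : `|m| * (1 - d) < `|m| * `|P f|.
  apply: lt_le_trans fm _; rewrite -norm_restrict mulrC.
  rewrite -(restrictE f (SubspaceOf mM)).
  exact: le_trans (ler_norm _) (dual_apply_le _ (SubspaceOf mM)).
by rewrite ltr_pM2l// => dP; move: f1; rewrite (LP.2 f); lra.
Qed.

(** Two far apart elements of a thin slice of the ball of [X^*] defined by [m]
    almost keep their distance under restriction, as both are close to the range
    of [P], where restriction is isometric. *)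
Lemma diam_slice_ge2 m alpha (mM : m \in M) : m != 0 -> 0 < alpha ->
  dual_wstar_slice_D2P X ->
  (2%:E <= diam (wstar_slice (SubspaceOf mM) alpha))%E.
Proof.
move=> m0 a0 D2P; apply: diam_ge2 => e e0.
have nm : 0 < `|m| by rewrite normr_gt0.
(* The loss is at most [e / 2] from the diameter in [X^*] and [e / 4] from each
   of the two functionals; [`|m| * (e / 4)] is the thickness that brings a
   functional within [e / 4] of its projection. *)
pose b := Num.min alpha (`|m| * (e / 4)).
have b0 : 0 < b by rewrite lt_min a0 mulr_gt0// divr_gt0.
have ba : b <= alpha by rewrite ge_min lexx.
have be : b <= `|m| * (e / 4) by rewrite ge_min lexx orbT.
have : ((2 - e / 2)%:E < diam (wstar_slice m b))%E.
  by rewrite D2P// lte_fin; lra.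
move=> /ereal_sup_gt[_ [[f g] /= fgS <-]]; move: fgS.
rewrite wstar_sliceE => -[[/= f1 fm] [/= g1 gm]]; rewrite lte_fin => fg.
have inslice (h : dual X) : `|h| <= 1 -> `|m| - b < h m ->
    `|restrict h| <= 1 /\ `|m| - alpha < restrict h (SubspaceOf mM).
  move=> h1 hm; rewrite restrictE/=; split; last by lra.
  exact: le_trans (norm_restrict_le h) h1.
have close (h : dual X) : `|h| <= 1 -> `|m| - b < h m -> `|h - P h| < e / 4.
  by move=> h1 hm; apply: (norm_sub_L_projection h m _ mM h1) => //; lra.
exists (restrict f), (restrict g); split.
- by rewrite wstar_sliceE; exact: inslice.
- by rewrite wstar_sliceE; exact: inslice.
rewrite -restrictB norm_restrict.
have : `|f - g - P (f - g)| <= `|f - P f| + `|g - P g|.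
  have -> : f - g - P (f - g) = (f - P f) - (g - P g).
    by rewrite linearB !opprD !addrA [f - g - P f]addrAC.
  exact: ler_normB.
have := close _ f1 fm; have := close _ g1 gm; have := LP.2 (f - g).
lra.
Qed.

End MIdeal.

Theorem corollary4 (R : realType) (X : completeNormedModType R)
    (M : submodClosed X) (M_neq0 : exists m, m \in M /\ m != 0)
    (M_ideal_X : M_ideal M) :
  dual_wstar_slice_D2P X -> dual_wstar_slice_D2P (subspace_of M).
Proof.
case: M_ideal_X => _ [P [LP kerP]] D2P m alpha a0.
apply/eqP; rewrite eq_le diam_le2 => [/=|f []//].
have [m0|m0] := eqVneq (val m) 0; last first.
  by case: m m0 => m mM /= m0; exact: (diam_slice_ge2 M P LP kerP).
(* At [m = 0] the slice is the whole ball; a slice defined by a nonzero vector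
   of [M] is contained in it and already has diameter at least 2. *)
have [w [wM w0]] := M_neq0.
apply: le_trans (diam_slice_ge2 M P LP kerP w alpha wM w0 a0 D2P) _.
have mE : m = 0 by apply/val_inj; rewrite m0 raddf0.
apply: ereal_sup_le; apply: image_subset.
suff sub : wstar_slice (SubspaceOf wM) alpha `<=` wstar_slice m alpha.
  by move=> -[f g] [/= /sub sf /sub sg].
rewrite !wstar_sliceE => f [f1 _]; split=> //.
by rewrite mE normr0 sub0r (linear0 (f : {linear _ -> R^o})) oppr_lt0.
Qed.
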